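(* Let $R$ be a commutative ring with unity, let $n,s\ge 1$, and let $$\mathcal{M}=\begin{pmatrix}\mathcal{A}&\mathcal{B}\\\mathcal{C}&\mathcal{D}\end{pmatrix}\in R^{(n+s)\times(n+s)},\quad \mathcal{A}\in R^{n\times n},\ \mathcal{B}\in R^{n\times s},\ \mathcal{C}\in R^{s\times n},\ \mathcal{D}\in R^{s\times s}.$$ Let $\mathcal{X},\mathcal{Y}\in R^{n\times n}$ be such that either both $\mathcal{X}$ and $\mathcal{Y}$ are regular, or the matrices $\mathcal{A},\mathcal{X},\mathcal{Y}$ commute pairwise. Let $f\in R$ and set $\tilde{\mathcal{A}}=f\mathbf{I}_n-\mathcal{X}\mathcal{A}\mathcal{Y}$. Let $\mathrm{a}(x)\in R[x]\setminus\{0\}$ satisfy $\mathrm{a}(\tilde{\mathcal{A}})=\mathbf{0}$, and set $$\mathcal{P}=\mathcal{Y}\,\mathrm{p}(f,\tilde{\mathcal{A}};\mathrm{a})\,\mathcal{X}\in R^{n\times n},\qquad \mathcal{S}=\mathrm{a}(f)\,\mathcal{D}-\mathcal{C}\mathcal{P}\mathcal{B}\in R^{s\times s}.$$ Then $$\left(\mathrm{a}(f)\right)^s\det(\mathcal{M})=\det(\mathcal{A})\det(\mathcal{S}).$$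
   Context: An element of $R$ is regular if it is nonzero and not a zero divisor; a square matrix over $R$ is regular if its determinant is regular. For a polynomial $\mathrm{a}(x)=\sum_{k=0}^{d}a_kx^k\in R[x]$, $f\in R$ and $\mathcal{Z}\in R^{n\times n}$, define $$\mathrm{p}(f,\mathcal{Z};\mathrm{a})=\mathrm{p}(f\mathbf{I}_n,\mathcal{Z};\mathrm{a})=\sum_{k=1}^{d}a_k\sum_{i=1}^{k}f^{\,i-1}\mathcal{Z}^{k-i}\in R^{n\times n}.$$ *)

(* Defs.v *)
From mathcomp Require Import all_boot all_order all_algebra.

Set Implicit Arguments.
Unset Strict Implicit.
Unset Printing Implicit Defensive.

Import GRing.Theory.
Local Open Scope ring_scope.

Definition zero_divisor (R : comNzRingType) (r : R) : Prop :=
  exists2 x : R, x != 0 & r * x = 0.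

(* For commutative R this amounts to GRing.lreg r. *)
Definition regular (R : comNzRingType) (r : R) : Prop :=
  r != 0 /\ ~ zero_divisor r.

Definition regular_mx (R : comNzRingType) (n : nat) (Z : 'M[R]_n) : Prop :=
  regular (\det Z).

(* The outer sum runs over 1 <= k <= d with d = (size a).-1 the degree of a;
   it is empty when a is constant.  Since i <= k, k - i is not truncated. *)
Definition pmx (R : comNzRingType) (n : nat) (f : R) (Z : 'M[R]_n.+1)
    (a : {poly R}) : 'M[R]_n.+1 :=
  \sum_(1 <= k < size a)
    a`_k *: \sum_(1 <= i < k.+1) f ^+ (i - 1) *: Z ^+ (k - i).

(* Main.v *)
(** The identity [a(f) - a(Z) = p(f, Z; a) (f - Z)] with [Z = f - X A Y] and
    [a(Z) = 0] gives [p X A Y = a(f)].  In either case of the hypothesis on [X] and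
    [Y] this yields [P A = a(f)], so that multiplying [M] on the left by the block
    lower triangular matrix with rows [(1, 0)] and [(- C P, a(f))] produces the block
    upper triangular matrix with diagonal blocks [A] and [S]; take determinants. *)
Require Import Defs.
From mathcomp Require Import all_boot all_order all_algebra.

Import GRing.Theory.
Local Open Scope ring_scope.

(** Multiplying by [f - Z] turns each summand into a difference of consecutive terms
    [f ^+ i *: Z ^+ (k - i)], so the sum telescopes. *)
Lemma telescope_scale_expr (R : comNzRingType) (n k : nat) (f : R)
    (Z : 'M[R]_n.+1) :
  (\sum_(1 <= i < k.+1) f ^+ (i - 1) *: Z ^+ (k - i)) *m (f%:M - Z)
    = (f ^+ k)%:M - Z ^+ k.
Proof.
rewrite mulmx_suml big_add1 /=.
rewrite (eq_big_nat _ _ (F2 := fun i =>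
  f ^+ i.+1 *: Z ^+ (k - i.+1) - f ^+ i *: Z ^+ (k - i))); last first.
  move=> i /andP[_ ltik].
  rewrite subn1 /= mulmxBr mul_mx_scalar scalerA -exprS -scalemxAl.
  (* Since [i < k], the subtraction [k - i.+1] is not truncated, and the extra factor [Z] raises the
     exponent to exactly [k - i]. *)
  by rewrite -[_ *m Z]/(_ * Z) -exprSr subnSK.
rewrite (telescope_sumr (fun i => f ^+ i *: Z ^+ (k - i))) //.
by rewrite subnn subn0 !expr0 scale1r -scalemx1.
Qed.

Lemma pmx_mul_sub (R : comNzRingType) (n : nat) (f : R) (Z : 'M[R]_n.+1)
    (a : {poly R}) :
  pmx f Z a *m (f%:M - Z) = (a.[f])%:M - horner_mx Z a.
Proof.
have -> : (a.[f])%:M - horner_mx Z a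
    = \sum_(0 <= k < size a) a`_k *: ((f ^+ k)%:M - Z ^+ k).
  rewrite big_mkord [X in _ - X](horner_coef_wide _ (size_poly _ _)).
  rewrite horner_coef raddf_sum -sumrB; apply: eq_bigr => k _.
  rewrite coef_map /= -[_ * Z ^+ k]/(_ *m Z ^+ k) mul_scalar_mx scalerBr.
  by rewrite scale_scalar_mx.
rewrite /pmx mulmx_suml.
under eq_bigr do rewrite -scalemxAl telescope_scale_expr.
(* For [a = 0] both sums are empty; otherwise the sum from 0 has one extra term, at [k = 0], which
   vanishes because [f ^+ 0] and [Z ^+ 0] are both the identity. *)
case: (size a) => [|m]; first by rewrite !big_geq.
by rewrite [RHS]big_nat_recl // !expr0 subrr scaler0 add0r big_add1.
Qed.

Lemma comm_mx_pmx (R : comNzRingType) (n : nat) (f : R) (W Z : 'M[R]_n.+1)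
    (a : {poly R}) :
  comm_mx W Z -> comm_mx W (pmx f Z a).
Proof.
move=> cWZ.
have comm_scale c V : comm_mx W V -> comm_mx W (c *: V).
  by rewrite /comm_mx -scalemxAl -scalemxAr => ->.
apply: comm_mx_sum => k _; apply/comm_scale.
by apply: comm_mx_sum => i _; apply/comm_scale; apply: commrX.
Qed.

(** The adjugate replaces [Y] by the scalar [\det Y]; a nonzero entry of [U - V] would then witness
    that [\det Y] is a zero divisor. *)
Lemma regular_mx_cancelr (R : comNzRingType) (m n : nat) (Y : 'M[R]_n)
    (U V : 'M[R]_(m, n)) :
  regular_mx Y -> U *m Y = V *m Y -> U = V.
Proof.
move=> [_ ndY] eqUV; apply/matrixP => i j; apply/eqP; rewrite -subr_eq0.
apply/negP => /negP neq0; apply: ndY; exists (U i j - V i j) => //.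
have /matrixP/(_ i j) : \det Y *: U = \det Y *: V.
  by rewrite -!mul_mx_scalar -mul_mx_adj !mulmxA eqUV.
by rewrite !mxE mulrBr => ->; rewrite subrr.
Qed.

(** A Schur complement formula cleared of denominators, with [P] in the role of [c] times an inverse
    of [A]. *)
Lemma det_block_left_quasi_inverse (R : comNzRingType) (n s : nat)
    (A P : 'M[R]_n) (B : 'M[R]_(n, s)) (C : 'M[R]_(s, n)) (D : 'M[R]_s) (c : R) :
  P *m A = c%:M ->
  c ^+ s * \det (block_mx A B C D) = \det A * \det (c *: D - C *m P *m B).
Proof.
move=> PA; pose L := block_mx 1%:M 0 (- (C *m P)) c%:M.
have -> : c ^+ s = \det L by rewrite det_lblock det1 mul1r det_scalar.
rewrite -det_mulmx mulmx_block !mul1mx !mul0mx !addr0 !mulNmx -[C *m P *m A]mulmxA.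
by rewrite PA mul_mx_scalar !mul_scalar_mx addNr det_ublock addrC.
Qed.

Theorem theorem1 (R : comNzRingType) (n s : nat)
    (A : 'M[R]_n.+1) (B : 'M[R]_(n.+1, s.+1))
    (C : 'M[R]_(s.+1, n.+1)) (D : 'M[R]_s.+1)
    (X Y : 'M[R]_n.+1)
    (hXY : (regular_mx X /\ regular_mx Y) \/
           [/\ comm_mx A X, comm_mx A Y & comm_mx X Y])
    (f : R) (a : {poly R}) (ha : a != 0) :
  let M : 'M[R]_(n.+1 + s.+1) := block_mx A B C D in
  let A' : 'M[R]_n.+1 := f%:M - X *m A *m Y in
  horner_mx A' a = 0 ->
  let P : 'M[R]_n.+1 := Y *m pmx f A' a *m X in
  let S : 'M[R]_s.+1 := a.[f] *: D - C *m P *m B in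
  a.[f] ^+ s.+1 * \det M = \det A * \det S.
Proof.
move=> M A' aA'0 P S; apply: det_block_left_quasi_inverse.
have QXAY : pmx f A' a *m (X *m A *m Y) = (a.[f])%:M.
  by have := pmx_mul_sub _ _ f A' a; rewrite aA'0 subr0 subKr.
case: hXY => [[_ regY] | [cAX cAY cXY]].
  (* After multiplication by [Y] on the right, [P A Y = Y (p X A Y) = Y a(f) = a(f) Y]. *)
  apply: (regular_mx_cancelr _ _ _ Y _ _ regY).
  by rewrite /P -!mulmxA [X *m _]mulmxA QXAY mul_mx_scalar mul_scalar_mx.
have cYA' : comm_mx Y A'.
  apply: comm_mxB; first exact: comm_mx_scalar.
  by apply: comm_mxM => //; apply: comm_mxM; apply: comm_mx_sym.
(* Moving [Y] past [p] gives [P A = p Y X A], and commutation turns [Y X A] into [X A Y]. *)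
rewrite /P (comm_mx_pmx _ _ f _ _ a cYA') -QXAY -!mulmxA cAY.
by rewrite [X *m (Y *m A)]mulmxA cXY !mulmxA.
Qed.
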